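(* For fixed $\sigma\in S_n$, both $\{[W_{\sigma,I}]\}_{I\in\mathcal I_\lambda}$ and $\{\kappa_{\sigma,I}\}_{I\in\mathcal I_\lambda}$ are bases of the $\mathbb C(z,h)$-module $K_T(T^*\mathcal F_\lambda)\otimes_{\mathbb C[z^{\pm1},h^{\pm1}]}\mathbb C(z,h)$, where $[W_{\sigma,I}]$ is the unique class with $[W_{\sigma,I}]|_{x_J}=W_{\sigma,I}(z_J,z,h)$ for all $J$, and $\kappa_{\sigma,I}=[\widetilde W_{\sigma,I}]$ is the unique class with $\kappa_{\sigma,I}|_{x_J}=\widetilde W_{\sigma,I}(z_J,z,h)$ for all $J$.
   Context: Fix $N,n$, $\lambda\in\mathbb Z_{\ge0}^N$, $\sum\lambda_k=n$; $\lambda^{(k)}=\lambda_1+\dots+\lambda_k$, $\lambda^{\{1\}}=\sum_{k=1}^{N-1}\lambda^{(k)}$. $\mathcal I_\lambda$ = ordered partitions $I=(I_1,\dots,I_N)$ of $\{1,\dots,n\}$ with $|I_k|=\lambda_k$; $I_1\cup\dots\cup I_k=\{i^{(k)}_1<\dots<i^{(k)}_{\lambda^{(k)}}\}$; $\sigma(I)=(\sigma(I_1),\dots,\sigma(I_N))$. $K_T(T^*\mathcal F_\lambda)=\mathbb C[\Gamma^{\pm1}]^{S_\lambda}\otimes\mathbb C[z^{\pm1},h^{\pm1}]/\langle f(\Gamma)=f(z),\ f\in\mathbb C[z^{\pm1}]^{S_n}\rangle$, $\Gamma=(\gamma_{k,a})_{k\le N,a\le\lambda_k}$, $S_\lambda=\prod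 S_{\lambda_k}$ permuting variables with the same first index. Restriction $[f]|_{x_J}$: substitution $\{\gamma_{k,1},\dots,\gamma_{k,\lambda_k}\}\mapsto\{z_a:a\in J_k\}$. Weight functions: variables $t^{(k)}_a$ ($1\le k\le N-1$), $t^{(N)}_a=z_a$; $U_I=\prod_{k=1}^{N-1}\prod_{a=1}^{\lambda^{(k)}}\Big(\prod_{c:\,i^{(k+1)}_c<i^{(k)}_a}(1-ht^{(k+1)}_c/t^{(k)}_a)\prod_{c:\,i^{(k+1)}_c>i^{(k)}_a}(1-t^{(k+1)}_c/t^{(k)}_a)\prod_{b=a+1}^{\lambda^{(k)}}\frac{1-ht^{(k)}_b/t^{(k)}_a}{1-t^{(k)}_b/t^{(k)}_a}\Big)$ ($c\in\{1..\lambda^{(k+1)}\}$); $W_I=(1-h)^{\lambda^{\{1\}}}\mathrm{Sym}_{t^{(1)}}\cdots\mathrm{Sym}_{t^{(N-1)}}U_I$ (sum over permutations within each group $t^{(k)}$); $W_{\sigma,I}(t,z,h)=W_{\sigma^{-1}(I)}(t,z_{\sigma(1)},\dots,z_{\sigma(n)},h)$; $E(t,h)=\prod_{k=1}^{N-1}\prod_{a,b}(1-ht^{(k)}_b/t^{(k)}_a)$; $\widetilde W_{\sigma,I}=W_{\sigma,I}/E$; $f(z_J,z,h)$ = substitution $t^{(k)}_a=z_{j^{(k)}_a}$ with $J_1\cup\dots\cup J_k=\{j^{(k)}_1<\dots\}$. *)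

(* Defs.v *)
From HB Require Import structures.
From mathcomp Require Import all_boot all_order all_algebra all_fingroup.
From mathcomp Require Import fraction.
Unset Printing Implicit Defensive.
Import Order.TTheory GRing.Theory Num.Theory.
Local Open Scope ring_scope.

Fixpoint mpoly (C : idomainType) (m : nat) : idomainType :=
  if m is m'.+1 then GRing.IntegralDomain.clone {poly mpoly C m'} _ else C.

Fixpoint mvar (C : idomainType) (m : nat) (i : nat) {struct m} : mpoly C m :=
  match m return mpoly C m with
  | 0 => 0
  | m'.+1 => if i is i'.+1 then (mvar C m' i')%:P else 'X
  end.

Fixpoint mconst (C : idomainType) (m : nat) (c : C) {struct m} : mpoly C m :=
  match m return mpoly C m with
  | 0 => c
  | m'.+1 => (mconst C m' c)%:P
  end.

Definition Fz (C : idomainType) (n : nat) : fieldType := {fraction (mpoly C n.+1)}.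
Definition hv (C : idomainType) (n : nat) : Fz C n := FracField.tofrac (mvar C n.+1 0).
Definition zv (C : idomainType) (n : nat) (a : nat) : Fz C n := FracField.tofrac (mvar C n.+1 a.+1).
Definition cF (C : idomainType) (n : nat) (c : C) : Fz C n := FracField.tofrac (mconst C n.+1 c).

(* A term (c, e) stands for c * x^e, with e : 'I_m -> int the exponent vector.       *)
Definition lpoly (R : Type) (m : nat) := seq (R * {ffun 'I_m -> int}).

Section Laurent.
Variables (R : comUnitRingType) (m : nat).
Implicit Types (p q : lpoly R m).
Definition lcoef p (e : {ffun 'I_m -> int}) : R := \sum_(t <- p | t.2 == e) t.1.
Definition lequiv p q : Prop := forall e, lcoef p e = lcoef q e.
Definition ladd p q : lpoly R m := p ++ q.
Definition lscale (c : R) p : lpoly R m := [seq (c * t.1, t.2) | t <- p].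
Definition lsub p q : lpoly R m := p ++ lscale (-1) q.
Definition lmul p q : lpoly R m :=
  [seq (a.1 * b.1, [ffun i => a.2 i + b.2 i])
   | a : R * {ffun 'I_m -> int} <- p, b : R * {ffun 'I_m -> int} <- q].
Definition lconst (c : R) : lpoly R m := [:: (c, [ffun=> 0%R])].
Definition leval p (x : 'I_m -> R) : R := \sum_(t <- p) t.1 * \prod_(i < m) x i ^ t.2 i.
Definition lperm (s : {perm 'I_m}) p : lpoly R m :=
  [seq (t.1, [ffun i => t.2 (s i)]) | t : R * {ffun 'I_m -> int} <- p].
End Laurent.
Arguments lcoef {R m}. Arguments lequiv {R m}. Arguments ladd {R m}.
Arguments lscale {R m}. Arguments lsub {R m}. Arguments lmul {R m}.
Arguments lconst {R} m. Arguments leval {R m}. Arguments lperm {R m}.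

Section FlagData.
Variables (C : numClosedFieldType) (N n : nat) (lam : 'I_N -> nat).

Local Notation F := (Fz C n).
(* the ordered partitions I = (I_1,...,I_N) of {1..n} with |I_k| = lam_k, encoded
   as the map sending an element (0-based) to the index (0-based) of its block *)
Definition OP := {ffun 'I_n -> 'I_N}.
Definition Ilam : {set OP} :=
  [set I : OP | [forall k : 'I_N, #|[set a | I a == k]| == lam k]].

Definition lamp (k : nat) : nat := (\sum_(i < N | (i < k)%N) lam i)%N.
Definition lam1 : nat := (\sum_(k < N.-1) lamp k.+1)%N.

(* 0-based: pos I k a = i^(k+1)_(a+1) - 1, the (a+1)-th smallest element of
   I_1 u ... u I_(k+1) *)
Definition pos (I : OP) (k a : nat) : nat :=
  nth 0%N [seq nat_of_ord i | i <- enum 'I_n & (I i < k.+1)%N] a.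
(* 0-based: the (a+1)-th smallest element of the block I_(k+1) *)
Definition posb (I : OP) (k a : nat) : nat :=
  nth 0%N [seq nat_of_ord i | i <- enum 'I_n & (nat_of_ord (I i) == k)] a.

Definition pact (s : {perm 'I_n}) (a : nat) : nat :=
  match (insub a : option 'I_n) with Some i => nat_of_ord (s i) | None => a end.

(* Variables: T k a = t^(k+1)_(a+1)  (k = 0..N-1, 0-based; T (N-1) = z). *)
Definition Ufun (I : OP) (T : nat -> nat -> F) (h : F) : F :=
  \prod_(k < N.-1) \prod_(a < lamp k.+1)
    ( (\prod_(c < lamp k.+2 | (pos I k.+1 c < pos I k a)%N) (1 - h * T k.+1 c / T k a))
    * (\prod_(c < lamp k.+2 | (pos I k a < pos I k.+1 c)%N) (1 - T k.+1 c / T k a))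
    * \prod_(b < lamp k.+1 | (a < b)%N) ((1 - h * T k b / T k a) / (1 - T k b / T k a))).

(* a family of permutations, one for each group t^(1),...,t^(N-1); the k-th one
   permutes the first lambda^(k) indices only, i.e. lies in S_{lambda^(k)} *)
Definition permfam := {ffun 'I_N.-1 -> {perm 'I_n}}.
Definition permfam_ok (s : permfam) : bool :=
  [forall k : 'I_N.-1, forall i : 'I_n, (lamp k.+1 <= i)%N ==> (s k i == i)].
Definition spick (s : permfam) (k a : nat) : nat :=
  match (insub k : option 'I_N.-1) with Some k' => pact (s k') a | None => a end.

Definition Wfun (I : OP) (T : nat -> nat -> F) (h : F) : F :=
  (1 - h) ^+ lam1 *
  \sum_(s : permfam | permfam_ok s) Ufun I (fun k a => T k (spick s k a)) h.

(* W_{sigma,I}(z_J, z, h) = W_{sigma^{-1}(I)}(z_J, z_{sigma(1)},...,z_{sigma(n)}, h) *)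
Definition Wsig (sigma : {perm 'I_n}) (I J : OP) : F :=
  Wfun [ffun i => I (sigma i)]
    (fun k a => if (k < N.-1)%N then zv C n (pos J k a) else zv C n (pact sigma a))
    (hv C n).

Definition Esub (J : OP) : F :=
  \prod_(k < N.-1) \prod_(a < lamp k.+1) \prod_(b < lamp k.+1)
     (1 - hv C n * zv C n (pos J k b) / zv C n (pos J k a)).

Definition Wtsig (sigma : {perm 'I_n}) (I J : OP) : F := Wsig sigma I J / Esub J.

(* ---------- K_T(T^*F_lam) (x) C(z,h) = F[Gamma^{+-1}]^{S_lam} / < f(Gamma) - f(z) > ---------- *)
(* Gamma variables are indexed by p : 'I_n; p corresponds to gamma_{k+1, p - lamp k + 1}
   where k = blk p is the (0-based) block with lamp k <= p < lamp (k+1). *)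
Definition blk (p : nat) : nat := (\sum_(k < N) (lamp k.+1 <= p))%N.

Definition Rinv (r : lpoly F n) : Prop :=
  forall s : {perm 'I_n}, (forall p : 'I_n, blk (s p) = blk p) -> lequiv (lperm s r) r.
Definition Ssym (f : lpoly C n) : Prop := forall s : {perm 'I_n}, lequiv (lperm s f) f.

Definition lmapc (f : lpoly C n) : lpoly F n := [seq (cF C n t.1, t.2) | t : C * {ffun 'I_n -> int} <- f].
Definition zvec : 'I_n -> F := fun i => zv C n i.

Definition inJ (r : lpoly F n) : Prop :=
  exists gs : seq (lpoly F n * lpoly C n),
    (forall g, g \in gs -> Rinv g.1 /\ Ssym g.2) /\
    lequiv r (flatten [seq lmul g.1 (lsub (lmapc g.2) (lconst n (leval (lmapc g.2) zvec)))
                       | g <- gs]).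

(* restriction to the fixed point x_J : {gamma_{k,1..lam_k}} |-> {z_a : a in J_k} *)
Definition xJ (J : OP) : 'I_n -> F :=
  fun p => zv C n (posb J (blk p) (p - lamp (blk p))).
Definition restr (r : lpoly F n) (J : OP) : F := leval r (xJ J).

Definition isClass (f : OP -> F) (r : lpoly F n) : Prop :=
  Rinv r /\ forall J, J \in Ilam -> restr r J = f J.

Definition lcomb (c : OP -> F) (b : OP -> lpoly F n) : lpoly F n :=
  flatten [seq lscale (c x) (b x) | x <- enum Ilam].

Definition isBasis (b : OP -> lpoly F n) : Prop :=
  (forall r, Rinv r -> exists c : OP -> F, inJ (lsub r (lcomb c b))) /\
  (forall c : OP -> F, inJ (lcomb c b) -> forall I, I \in Ilam -> c I = 0).

Definition classes_form_basis (f : OP -> OP -> F) : Prop :=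
  [/\ forall I, I \in Ilam -> exists r, isClass (f I) r,
      forall I, I \in Ilam -> forall r r', isClass (f I) r -> isClass (f I) r' ->
                                           inJ (lsub r r')
    & forall b : OP -> lpoly F n, (forall I, I \in Ilam -> isClass (f I) (b I)) ->
                                 isBasis b].
End FlagData.

(* Main.v *)
(* Write z_w for the point (z_(w 1), ..., z_(w n)).  A Laurent polynomial over a field
   of characteristic 0 is determined by its values on the torus, so all identities
   between Laurent polynomials are checked pointwise.

   Restriction to the fixed points is an isomorphism onto the functions on I_lambda.
   Let l_a be the Lagrange interpolation polynomials of the nodes z_1, ..., z_n and
   e_u = prod_i l_(u i)(gamma_i) for u : [n] -> [n].  The e_u sum to 1, and modulo the
   ideal generated by the e_k(gamma) - e_k(z) one has r e_u = r(z_u) e_u for every r;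
   taking r = e_k shows that e_u is in the ideal when u is not a bijection.  Hence
   an r vanishing at all z_w, w in S_n, lies in the ideal, and averaging over S_lambda
   makes the coefficients invariant.  Conversely sum_w f(J_w) e_w has prescribed
   restrictions f.

   It remains to see that the matrix W_(sigma,I)(z_J) is invertible.  A nonzero term of
   the symmetrization at z_J yields bijections from I_1 u ... u I_k to J_1 u ... u J_k
   which do not increase sigma^-1, for every k.  So the matrix is triangular with
   respect to the sum over k of the sum of sigma^-1 over I_1 u ... u I_k, and on the
   diagonal exactly one term survives. *)
Require Import Defs.
From HB Require Import structures.
From mathcomp Require Import all_boot all_order all_algebra all_fingroup.
From mathcomp Require Import fraction.
From mathcomp Require Import ring zify.
Set Implicit Arguments.
Unset Strict Implicit.
Import Order.TTheory GRing.Theory Num.Theory.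
Local Open Scope ring_scope.

(** * Laurent polynomials as functions on the torus *)

Section Laurent.
Variables (K : fieldType) (m : nat).
Implicit Types (p q r : lpoly K m) (x : 'I_m -> K) (e : {ffun 'I_m -> int}).

Definition torus x := forall i, x i != 0.

Definition lmonom e x : K := \prod_(i < m) x i ^ e i.

Lemma leval_cat p q x : leval (p ++ q) x = leval p x + leval q x.
Proof. by rewrite /leval big_cat. Qed.

Lemma leval_scale c p x : leval (lscale c p) x = c * leval p x.
Proof.
rewrite /leval big_map mulr_sumr; apply: eq_bigr => t _ /=; exact: esym (mulrA _ _ _).
Qed.

Lemma leval_sub p q x : leval (lsub p q) x = leval p x - leval q x.
Proof. by rewrite leval_cat leval_scale mulN1r. Qed.

Lemma leval_const c x : leval (lconst m c) x = c.
Proof.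
by rewrite /leval big_seq1 big1 ?mulr1 // => i _; rewrite ffunE expr0z.
Qed.

Lemma leval_flatten (T : Type) (s : seq T) (f : T -> lpoly K m) x :
  leval (flatten [seq f t | t <- s]) x = \sum_(t <- s) leval (f t) x.
Proof. by rewrite /leval big_flatten big_map. Qed.

Lemma leval_mul p q x : torus x -> leval (lmul p q) x = leval p x * leval q x.
Proof.
move=> x0; rewrite /leval /lmul big_flatten big_map mulr_suml; apply: eq_bigr => s _.
rewrite big_map mulr_sumr; apply: eq_bigr => t _ /=.
rewrite mulrACA -big_split /=; congr (_ * _); apply: eq_bigr => i _.
by rewrite ffunE expfzDr.
Qed.

Lemma leval_perm (s : {perm 'I_m}) p x :
  leval (lperm s p) x = leval p (fun i => x ((s^-1)%g i)).
Proof.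
rewrite /leval big_map; apply: eq_bigr => t _ /=; congr (_ * _).
rewrite [RHS](reindex_inj (@perm_inj _ s)) /=.
by apply: eq_bigr => i _; rewrite ffunE permK.
Qed.

Lemma eq_leval p x y : x =1 y -> leval p x = leval p y.
Proof.
by move=> xy; apply: eq_bigr => t _; congr (_ * _); apply: eq_bigr => i _; rewrite xy.
Qed.

(** An [lpoly] may repeat exponents, so two of them are compared by collecting coefficients over one
    common duplicate-free list [s], which may be larger than either support. *)
Lemma leval_lcoef (s : seq {ffun 'I_m -> int}) p x :
    uniq s -> {subset [seq t.2 | t <- p] <= s} ->
  leval p x = \sum_(e <- s) lcoef p e * lmonom e x.
Proof.
move=> us sub; rewrite (eq_bigr (fun e => \sum_(t <- p | t.2 == e) t.1 * lmonom e x)); last first.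
  by move=> e _; rewrite mulr_suml.
rewrite (exchange_big_dep xpredT) //= /leval !big_seq; apply: eq_bigr => t tp.
rewrite [RHS]big_mkcond (bigD1_seq t.2) ?sub ?map_f //= eqxx.
by rewrite [X in _ + X]big1 ?addr0 // => e /negbTE et; rewrite eq_sym et.
Qed.

Lemma lcoef_notin p e : e \notin [seq t.2 | t <- p] -> lcoef p e = 0.
Proof.
move=> ep; rewrite /lcoef big_seq_cond big1 // => t /andP[tp /eqP te].
by rewrite -te map_f in ep.
Qed.

Let exps p q := undup ([seq t.2 | t <- p] ++ [seq t.2 | t <- q]).

Lemma lequiv_leval p q x : lequiv p q -> leval p x = leval q x.
Proof.
move=> pq; rewrite !(@leval_lcoef (exps p q)) ?undup_uniq //.
- by apply: eq_bigr => e _; rewrite pq.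
- by move=> e eq; rewrite mem_undup mem_cat eq orbT.
- by move=> e ep; rewrite mem_undup mem_cat ep.
Qed.

Hypothesis pcharK : [pchar K] =i pred0.

(** Characteristic 0 enters here: 2^(j+1) - 1 is a nonzero natural number. Negative exponents reduce
    to positive ones by inversion. *)
Lemma expz2_neq1 (k : int) : k != 0 -> (2 : K) ^ k != 1.
Proof.
have pow2 j : (2 : K) ^+ j.+1 != 1.
  rewrite -subr_eq0 -natrX -[1]/(1%:R) -natrB ?expn_gt0 //.
  by rewrite ((pcharf0P K).1 pcharK) subn_eq0 -ltnNge -[1%N](expn0 2) ltn_exp2l.
case: k => [[|j]|j] // _; first exact: pow2.
by rewrite NegzE -exprz_inv -exprnP exprVn invr_eq1 pow2.
Qed.

(* Dedekind's independence of characters: distinct monomials are distinct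
   characters of the torus, separated by the points with one coordinate 2. *)
Lemma lmonom_free (s : seq {ffun 'I_m -> int}) (c : {ffun 'I_m -> int} -> K) :
    uniq s -> (forall x, torus x -> \sum_(e <- s) c e * lmonom e x = 0) ->
  forall e, e \in s -> c e = 0.
Proof.
elim: s c => // e0 s IH c /= /andP[e0s us] sum0.
have lmonomM e x y : lmonom e (fun i => x i * y i) = lmonom e x * lmonom e y.
  by rewrite -big_split /=; apply: eq_bigr => i _; rewrite expfzMl.
have cs e : e \in s -> c e = 0.
  move=> es; have /eqP/ffunP/eqfunP : e0 != e by apply: contraNneq e0s => ->.
  case/forallPn=> i ei.
  pose y (j : 'I_m) : K := if j == i then 2 else 1.
  have y0 : torus y by move=> j; rewrite /y; case: ifP; rewrite ?oner_eq0 // ((pcharf0P K).1 pcharK).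
  have ye e' : lmonom e' y = 2 ^ e' i.
    rewrite /lmonom (bigD1 i) //= /y eqxx big1 ?mulr1 // => j /negbTE ->.
    by rewrite exp1rz.
  (* Subtracting [lmonom e0 y] times the relation at x from the relation at xy cancels the [e0]
     term, so the induction hypothesis applies to the shorter list [s]. *)
  have /eqP : c e * (lmonom e y - lmonom e0 y) = 0.
    apply: (IH (fun e' => c e' * (lmonom e' y - lmonom e0 y)) us _ e es) => x x0.
    have xy0 : torus (fun i => x i * y i) by move=> j; rewrite mulf_neq0 ?x0 ?y0.
    have := sum0 _ xy0; have := sum0 _ x0; rewrite !big_cons => E1 E2.
    have := congr2 (fun a b => a - lmonom e0 y * b) E2 E1.
    rewrite mulr0 subr0 mulrDr opprD addrACA lmonomM.
    set a := (X in X + _); have -> : a = 0 by rewrite /a; ring.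
    rewrite add0r mulr_sumr -sumrB => H; rewrite -[RHS]H.
    by apply: eq_bigr => e' _; rewrite lmonomM; ring.
  rewrite mulf_eq0 orbC subr_eq0 !ye; case: eqP => [E|_ /eqP //].
  have : (2 : K) ^ (e0 i - e i) != 1 by rewrite expz2_neq1 // subr_eq0.
  rewrite expfzDr ?((pcharf0P K).1 pcharK) // -E -expfzDr ?((pcharf0P K).1 pcharK) //.
  by rewrite subrr expr0z eqxx.
move=> e; rewrite inE => /orP[/eqP ->|/cs //].
(* All other coefficients vanish, so evaluating at (1, ..., 1) isolates [c e0]. *)
have := sum0 (fun=> 1) (fun _ => oner_neq0 _); rewrite big_cons big_seq big1; last first.
  by move=> e' /cs ->; rewrite mul0r.
by rewrite addr0 /lmonom big1 ?mulr1 // => i _; rewrite exp1rz.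
Qed.

Lemma leval_lequiv p q :
  (forall x, torus x -> leval p x = leval q x) -> lequiv p q.
Proof.
move=> pq e; case: (boolP (e \in exps p q)) => [|]; last first.
  by rewrite mem_undup mem_cat negb_or => /andP[ep eq]; rewrite !lcoef_notin.
move=> es; apply/eqP; rewrite -subr_eq0; apply/eqP; move: e es.
apply: (lmonom_free (s := exps p q) (c := fun e => lcoef p e - lcoef q e)); rewrite ?undup_uniq // => x x0.
under eq_bigr do rewrite mulrBl.
rewrite sumrB -!leval_lcoef ?undup_uniq ?pq ?subrr //.
- by move=> e eq; rewrite mem_undup mem_cat eq orbT.
- by move=> e ep; rewrite mem_undup mem_cat ep.
Qed.

End Laurent.

(** * The ideal generated by e_k(gamma) - e_k(z) *)

Section Interpolation.
Variables (K : fieldType) (n : nat) (z : 'I_n -> K).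
Implicit Types (x : 'I_n -> K) (phi psi : ('I_n -> K) -> K) (u : {ffun 'I_n -> 'I_n}).

(** Only values on the torus count: the convention [0^-1 = 0] breaks multiplicativity of evaluation
    at points with a zero coordinate. *)
Definition regular phi := exists p : lpoly K n, forall x, torus x -> leval p x = phi x.

Lemma regular_const c : regular (fun=> c).
Proof. by exists (lconst n c) => x _; rewrite leval_const. Qed.

Lemma regularD phi psi : regular phi -> regular psi -> regular (fun x => phi x + psi x).
Proof.
by move=> [p hp] [q hq]; exists (p ++ q) => x x0; rewrite leval_cat hp ?hq.
Qed.

Lemma regularM phi psi : regular phi -> regular psi -> regular (fun x => phi x * psi x).
Proof.
by move=> [p hp] [q hq]; exists (lmul p q) => x x0; rewrite leval_mul // hp ?hq.
Qed.

Lemma regular_monom (i : 'I_n) (k : int) : regular (fun x => x i ^ k).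
Proof.
exists [:: (1, [ffun j => if j == i then k else 0])] => x x0.
rewrite /leval big_seq1 mul1r (bigD1 i) //= ffunE eqxx big1 ?mulr1 // => j /negbTE ji.
by rewrite ffunE ji expr0z.
Qed.

Lemma regular_var i : regular (fun x => x i).
Proof. exact: (regular_monom i 1). Qed.

Lemma regular_sum (I : Type) (s : seq I) (P : pred I) (f : I -> ('I_n -> K) -> K) :
  (forall i, regular (f i)) -> regular (fun x => \sum_(i <- s | P i) f i x).
Proof.
move=> rf; elim: s => [|i s IH].
  by have [p hp] := regular_const 0; exists p => x x0; rewrite big_nil hp.
have [p hp] := regularD (rf i) IH; have [q hq] := IH.
by case Pi : (P i); [exists p | exists q] => x x0; rewrite big_cons Pi ?hp ?hq.
Qed.

Lemma regular_prod (I : Type) (s : seq I) (P : pred I) (f : I -> ('I_n -> K) -> K) :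
  (forall i, regular (f i)) -> regular (fun x => \prod_(i <- s | P i) f i x).
Proof.
move=> rf; elim: s => [|i s IH].
  by have [p hp] := regular_const 1; exists p => x x0; rewrite big_nil hp.
have [p hp] := regularM (rf i) IH; have [q hq] := IH.
by case Pi : (P i); [exists p | exists q] => x x0; rewrite big_cons Pi ?hp ?hq.
Qed.

Definition esymv (k : nat) x : K := \sum_(A : {set 'I_n} | #|A| == k) \prod_(i in A) x i.

(** The ideal is taken in all Laurent polynomials, without invariance of the coefficients; averaging
    over the block-preserving permutations restores invariance later. *)
Definition symideal phi := exists g : nat -> lpoly K n, forall x, torus x ->
  phi x = \sum_(k < n.+1) leval (g k) x * (esymv k x - esymv k z).

Lemma eq_symideal phi psi :
  (forall x, torus x -> phi x = psi x) -> symideal phi -> symideal psi.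
Proof. by move=> e [g hg]; exists g => x x0; rewrite -e ?hg. Qed.

Lemma symideal0 : symideal (fun=> 0).
Proof.
by exists (fun=> [::]) => x _; rewrite big1 // => k _; rewrite /leval big_nil mul0r.
Qed.

Lemma symidealD phi psi : symideal phi -> symideal psi -> symideal (fun x => phi x + psi x).
Proof.
move=> [p hp] [q hq]; exists (fun k => p k ++ q k) => x x0; rewrite hp ?hq //.
by rewrite -big_split; apply: eq_bigr => k _; rewrite leval_cat mulrDl.
Qed.

Lemma symidealM phi psi : regular phi -> symideal psi -> symideal (fun x => phi x * psi x).
Proof.
move=> [p hp] [g hg]; exists (fun k => lmul p (g k)) => x x0; rewrite hg //.
by rewrite -hp // mulr_sumr; apply: eq_bigr => k _; rewrite leval_mul // mulrA.
Qed.

Lemma symideal_sum (I : Type) (s : seq I) (P : pred I) (f : I -> ('I_n -> K) -> K) :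
  (forall i, P i -> symideal (f i)) -> symideal (fun x => \sum_(i <- s | P i) f i x).
Proof.
move=> rf; elim: s => [|i s IH].
  by apply: eq_symideal symideal0 => x _; rewrite big_nil.
case Pi : (P i); last by apply: eq_symideal IH => x _; rewrite big_cons Pi.
by apply: eq_symideal (symidealD (rf i Pi) IH) => x _; rewrite big_cons Pi.
Qed.

Lemma symideal_esym (k : 'I_n.+1) : symideal (fun x => esymv k x - esymv k z).
Proof.
exists (fun j => if j == k :> nat then lconst n 1 else [::]) => x x0.
rewrite (bigD1 k) //= eqxx leval_const mul1r big1 ?addr0 // => j jk.
by rewrite (negbTE jk : (j == k :> nat) = false) /leval big_nil mul0r.
Qed.

(** Vieta: expand the product, [A] being the set of factors that contribute [- x i]. *)
Lemma prod_subr_esym (y : K) x :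
  \prod_i (y - x i) = \sum_(k < n.+1) (-1) ^+ k * y ^+ (n - k) * esymv k x.
Proof.
under eq_bigr do rewrite addrC.
rewrite bigA_distr (partition_big (fun A : {set 'I_n} => inord #|A| : 'I_n.+1) xpredT) //=.
apply: eq_bigr => k _; rewrite mulr_sumr; apply: eq_big => A.
  by rewrite -(inj_eq val_inj) /= inordK // ltnS -[X in (_ <= X)%N]card_ord max_card.
move=> /eqP Ak; have <- : #|A| = k.
  by rewrite -Ak inordK // ltnS -[X in (_ <= X)%N]card_ord max_card.
rewrite (bigID (mem A)) /= mulrAC; congr (_ * _).
  by rewrite -prodrN; apply: eq_bigr => i ->.
rewrite (eq_bigr (fun=> y)) ?prodr_const => [|i /negbTE -> //]; congr (_ ^+ _).
by have := cardC (mem A); rewrite card_ord => nE; rewrite -[X in (X - _)%N]nE addKn.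
Qed.

Hypothesis zinj : injective z.

(** Subtract [\prod_a (x i - x a)], which is 0, and expand both products by Vieta: only multiples of
    the e_k(x) - e_k(z) remain. *)
Lemma symideal_root (i : 'I_n) : symideal (fun x => \prod_a (x i - z a)).
Proof.
apply: (@eq_symideal (fun x => \sum_(k < n.+1)
   (- (-1) ^+ k * x i ^+ (n - k)) * (esymv k x - esymv k z))) => [x x0|].
  have : \prod_a (x i - x a) = 0 by rewrite (bigD1 i) //= subrr mul0r.
  rewrite !prod_subr_esym => x00; rewrite -[RHS]subr0 -[X in _ = _ - X]x00 -sumrB.
  by apply: eq_bigr => k _; ring.
apply: symideal_sum => k _; apply: symidealM; last exact: symideal_esym.
by apply: regularM; [exact: regular_const | exact: (regular_monom i (n - k)%N)].
Qed.

(** * Lagrange partition of unity and eigenvalues modulo the ideal *)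

Definition ell (a : 'I_n) (y : K) : K := \prod_(b | b != a) ((y - z b) / (z a - z b)).

Lemma ell_z a c : ell a (z c) = (a == c)%:R.
Proof.
rewrite /ell; case: eqP => [->|/eqP ac].
  by rewrite big1 // => b bc; rewrite divff // subr_eq0 (inj_eq zinj) eq_sym.
by rewrite (bigD1 c) 1?eq_sym //= subrr !mul0r.
Qed.

(** The sum minus 1 is a polynomial of degree below n with the n distinct roots [z a]. The argument
    [i0] records n > 0: for n = 0 the sum is empty. *)
Lemma sum_ell (i0 : 'I_n) y : \sum_a ell a y = 1.
Proof.
pose L a := \prod_(b | b != a) (z a - z b)^-1 *: \prod_(b | b != a) ('X - (z b)%:P).
have LE a c : (L a).[c] = ell a c.
  rewrite hornerZ horner_prod -big_split; apply: eq_bigr => b _ /=.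
  by rewrite hornerXsubC mulrC.
have -> : \sum_a ell a y = (\sum_a L a).[y].
  by rewrite horner_sum; apply: eq_bigr => a _; rewrite LE.
suff /eqP : \sum_a L a - 1 = 0 by rewrite subr_eq0 => /eqP ->; rewrite hornerC.
have n0 : (0 < n)%N by apply: leq_ltn_trans (ltn_ord i0).
apply: (@roots_geq_poly_eq0 _ _ [seq z a | a <- enum 'I_n]).
- apply/allP => _ /mapP[c _ ->]; rewrite rootE !hornerE horner_sum.
  rewrite (bigD1 c) //= LE ell_z eqxx big1 ?addr0 ?subrr // => a /negbTE ac.
  by rewrite LE ell_z ac.
- by rewrite map_inj_uniq ?enum_uniq.
rewrite size_map size_enum_ord (leq_trans (size_polyD _ _)) // geq_max size_polyN size_poly1 n0.
rewrite andbT (leq_trans (size_sum _ _ _)) //; apply/bigmax_leqP => a _.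
rewrite (leq_trans (size_scale_leq _ _)) // (leq_trans (size_prod_leq _ _)) //.
rewrite (eq_bigr (fun=> 2%N)) => [|b _]; last by rewrite size_XsubC.
rewrite sum_nat_const muln2 -addnn -addSn addnK cardC1 card_ord.
by rewrite prednK.
Qed.

Definition eu u x : K := \prod_i ell (u i) (x i).

Lemma regular_ell a i : regular (fun x => ell a (x i)).
Proof.
apply: regular_prod => b; apply: regularM; last exact: regular_const.
apply: regularD; [exact: regular_var | exact: regular_const].
Qed.

Lemma regular_eu u : regular (eu u).
Proof. by apply: regular_prod => i; apply: regular_ell. Qed.

Lemma sum_eu x : \sum_u eu u x = 1.
Proof.
rewrite -(bigA_distr_bigA (fun i a => ell a (x i))) /= big1 // => i _.
exact: sum_ell.
Qed.

(** The factor [x i - z (u i)] is exactly the one missing from the numerator of [ell (u i) (x i)],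
    so the product is a multiple of [\prod_a (x i - z a)]. *)
Lemma symideal_eu_var u i : symideal (fun x => (x i - z (u i)) * eu u x).
Proof.
apply: (@eq_symideal (fun x => (\prod_(b | b != u i) (z (u i) - z b)^-1 *
   \prod_(j | j != i) ell (u j) (x j)) * \prod_a (x i - z a))) => [x x0|].
  have -> : eu u x = \prod_(b | b != u i) (x i - z b) *
      \prod_(b | b != u i) (z (u i) - z b)^-1 * \prod_(j | j != i) ell (u j) (x j).
    by rewrite /eu (bigD1 i) //= -big_split.
  by rewrite (bigD1 (u i) (P := xpredT)) //=; ring.
apply: symidealM; last exact: symideal_root.
apply: regularM; first exact: regular_const.
by apply: regular_prod => j; apply: regular_ell.
Qed.

Hypothesis z0 : torus z.

(** Modulo the ideal, [eu u] is an eigenvector of multiplication by [phi], with eigenvalue [c].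
    Regularity is carried along because the product rule uses [phi] as a coefficient. *)
Definition eu_eigen u phi c := regular phi /\ symideal (fun x => (phi x - c) * eu u x).

Lemma eu_eigenM u phi psi c d : eu_eigen u phi c -> eu_eigen u psi d ->
  eu_eigen u (fun x => phi x * psi x) (c * d).
Proof.
move=> [rphi iphi] [rpsi ipsi]; split; first exact: regularM.
(* phi psi - c d = phi (psi - d) + d (phi - c). *)
apply: eq_symideal (symidealD (symidealM rphi ipsi) (symidealM (regular_const d) iphi)) => x _.
ring.
Qed.

Lemma eu_eigenC u c : eu_eigen u (fun=> c) c.
Proof.
by split; [exact: regular_const | apply: eq_symideal symideal0 => x _; rewrite subrr mul0r].
Qed.

Lemma eu_eigenD u phi psi c d : eu_eigen u phi c -> eu_eigen u psi d ->
  eu_eigen u (fun x => phi x + psi x) (c + d).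
Proof.
move=> [rphi iphi] [rpsi ipsi]; split; first exact: regularD.
by apply: eq_symideal (symidealD iphi ipsi) => x _; ring.
Qed.

Lemma eq_eu_eigen u phi psi c d : (forall x, torus x -> phi x = psi x) -> c = d ->
  eu_eigen u phi c -> eu_eigen u psi d.
Proof.
move=> e <- [[p hp] iphi]; split; first by exists p => x x0; rewrite hp ?e.
by apply: eq_symideal iphi => x x0; rewrite e.
Qed.

Lemma eu_eigen_monom u i (k : int) : eu_eigen u (fun x => x i ^ k) (z (u i) ^ k).
Proof.
have H1 : eu_eigen u (fun x => x i) (z (u i)).
  by split; [exact: regular_var | exact: symideal_eu_var].
have HV : eu_eigen u (fun x => (x i)^-1) (z (u i))^-1.
  have rV : regular (fun x : 'I_n -> K => (x i)^-1).
    by have [p hp] := regular_monom i (-1); exists p => x x0; rewrite hp // exprN1.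
  split=> //.
  (* With z for [z (u i)]: 1/x - 1/z = - (1/z) (1/x) (x - z). *)
  apply: eq_symideal (symidealM (regularM (regular_const (- (z (u i))^-1)) rV)
    (symideal_eu_var u i)) => x x0.
  by rewrite mulrA; congr (_ * _); field; rewrite x0 z0.
have HX phi c m : eu_eigen u phi c -> eu_eigen u (fun x => phi x ^+ m) (c ^+ m).
  move=> H; elim: m => [|m IH]; first exact: eu_eigenC.
  by apply: eq_eu_eigen (eu_eigenM H IH) => [x _|]; rewrite exprS.
case: k => m; first exact: HX H1.
apply: eq_eu_eigen (HX _ _ m.+1 HV) => [x _|]; rewrite NegzE exprVn //.
Qed.

Lemma eu_eigen_leval u (p : lpoly K n) : eu_eigen u (leval p) (leval p (fun i => z (u i))).
Proof.
elim: p => [|t p IH].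
  by apply: eq_eu_eigen (eu_eigenC u 0) => [x _|]; rewrite /leval big_nil.
have Hm (s : seq 'I_n) : eu_eigen u (fun x => \prod_(i <- s) x i ^ t.2 i)
    (\prod_(i <- s) z (u i) ^ t.2 i).
  elim: s => [|i s IHs].
    by apply: eq_eu_eigen (eu_eigenC u 1) => [x _|]; rewrite big_nil.
  by apply: eq_eu_eigen (eu_eigenM (eu_eigen_monom u i (t.2 i)) IHs) => [x _|]; rewrite big_cons.
by apply: eq_eu_eigen (eu_eigenD (eu_eigenM (eu_eigenC u t.1) (Hm _)) IH) => [x _|];
   rewrite /leval big_cons.
Qed.

(* If [u] misses the value [a], the polynomials prod_i (y - z (u i)) and
   prod_i (y - z i) differ at [y = z a], so some e_k separates [z \o u] from [z]. *)
Lemma symideal_eu u : ~ injective u -> symideal (eu u).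
Proof.
move=> uninj; have [a ua] : exists a, a \notin codom u.
  apply/existsP; rewrite -negb_forall; apply/negP => /forallP usurj; apply: uninj.
  apply/injectiveP/card_uniqP; rewrite size_map -cardE.
  by apply: eq_card => a; rewrite usurj.
have [k ek] : exists k : 'I_n.+1, esymv k (fun i => z (u i)) != esymv k z.
  apply/existsP; rewrite -[X in is_true X]negbK negb_exists; apply/negP => /forallP eqe.
  have : \prod_i (z a - z (u i)) = \prod_i (z a - z i).
    by rewrite !prod_subr_esym; apply: eq_bigr => k _; have /negPn/eqP -> := eqe k.
  rewrite [RHS](bigD1 a) //= subrr mul0r => /eqP/prodf_eq0[i _].
  by rewrite subr_eq0 (inj_eq zinj) => /eqP ai; rewrite ai codom_f in ua.
have [p hp] : regular (esymv k).
  by apply: regular_sum => A; apply: regular_prod => i; apply: regular_var.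
have := (eu_eigen_leval u p).2; rewrite hp => [iu|i]; last exact: z0.
have iz : symideal (fun x => eu u x * (esymv k x - esymv k z)).
  by apply: symidealM; [exact: regular_eu | exact: symideal_esym].
(* On [eu u], e_k acts both by its value at [z \o u] and, modulo its own generator, by e_k(z). The
   difference of the two relations puts [d * eu u] in the ideal, and [d] is invertible. *)
pose d := esymv k (fun i => z (u i)) - esymv k z.
apply: eq_symideal (symidealM (regular_const (d^-1)) (symidealD iz
   (symidealM (regular_const (-1)) iu))) => x x0.
rewrite hp // -[RHS](mulKf (x := d)) ?subr_eq0 //; congr (_ * _).
by rewrite /d; ring.
Qed.

Lemma vanishing_symideal (p : lpoly K n) :
  (forall w : {perm 'I_n}, leval p (fun i => z (w i)) = 0) -> symideal (leval p).
Proof.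
move=> p0.
apply: (@eq_symideal (fun x => \sum_u leval p x * eu u x)) => [x _|].
  by rewrite -mulr_sumr sum_eu mulr1.
apply: symideal_sum => u _; case: (boolP (injectiveb u)) => [/injectiveP ui|/injectiveP ui].
  apply: eq_symideal (eu_eigen_leval u p).2 => x _; congr (_ * _).
  rewrite -[RHS]subr0; congr (_ - _); rewrite -[RHS](p0 (perm ui)).
  by apply: eq_leval => i; rewrite permE.
by apply: symidealM (symideal_eu ui); exists p.
Qed.

Lemma eu_perm (u w : {perm 'I_n}) :
  eu [ffun i => u i] (fun i => z (w i)) = (u == w)%:R.
Proof.
rewrite /eu; case: eqP => [->|/eqP uw].
  by rewrite big1 // => i _; rewrite ffunE ell_z eqxx.
have [i ui] : exists i, u i != w i.
  apply/existsP; rewrite -negb_forall; apply: contraNN uw => /forallP uw.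
  by apply/eqP/permP => i; apply/eqP.
by rewrite (bigD1 i) //= ffunE ell_z (negbTE ui) mul0r.
Qed.

End Interpolation.

(** * The field C(z, h) *)

Section EsymLaurent.
Variables (K : fieldType) (n : nat).

(** The field is arbitrary because e_k is needed twice: over C, as a generator allowed by [inJ], and
    over C(z,h), where it is evaluated. *)
Definition esymL (k : nat) : lpoly K n :=
  [seq (1, [ffun i => Posz (i \in A)]) | A : {set 'I_n} <- index_enum {set 'I_n} & #|A| == k].

Lemma leval_esymL k x : leval (esymL k) x = esymv k x.
Proof.
rewrite /leval /esymL big_map big_filter; apply: eq_bigr => A _ /=.
rewrite mul1r [RHS]big_mkcond; apply: eq_bigr => i _; rewrite ffunE.
by case: (i \in A).
Qed.

Lemma esymv_perm k (x : 'I_n -> K) (s : {perm 'I_n}) : esymv k (fun i => x (s i)) = esymv k x.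
Proof.
rewrite /esymv [RHS](reindex_inj (imset_inj (@perm_inj _ s))) /=.
apply: eq_big => A; first by rewrite card_imset //; apply: perm_inj.
by move=> _; rewrite big_imset //= => i j _ _; apply: perm_inj.
Qed.

End EsymLaurent.

Section FunctionField.
Variables (C : numClosedFieldType) (n : nat).
Local Notation F := (Fz C n).

Lemma mconst0 m : mconst C m 0 = 0.
Proof. by elim: m => //= m ->. Qed.

Lemma mconst1 m : mconst C m 1 = 1.
Proof. by elim: m => //= m ->. Qed.

Lemma mconstD m c d : mconst C m (c + d) = mconst C m c + mconst C m d.
Proof. by elim: m => //= m ->; rewrite polyCD. Qed.

Lemma mconst_eq0 m c : (mconst C m c == 0) = (c == 0).
Proof. by elim: m => //= m <-; rewrite polyC_eq0. Qed.

Lemma cF0 : cF C n 0 = 0. Proof. by rewrite /cF mconst0 tofrac0. Qed.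
Lemma cF1 : cF C n 1 = 1. Proof. by rewrite /cF mconst1 tofrac1. Qed.
Lemma cFD c d : cF C n (c + d) = cF C n c + cF C n d.
Proof. by rewrite /cF mconstD tofracD. Qed.

Lemma pchar_Fz : [pchar F] =i pred0.
Proof.
apply/pcharf0P => k; have -> : k%:R = cF C n k%:R :> F.
  by elim: k => [|k IH]; rewrite ?cF0 // -!natr1 cFD cF1 IH.
by rewrite /cF tofrac_eq0 mconst_eq0 pnatr_eq0.
Qed.

Lemma mvar_neq0 m i : (i < m)%N -> mvar C m i != 0.
Proof. by elim: m i => //= m IH [|i] im; rewrite ?polyX_eq0 // polyC_eq0 IH. Qed.

Lemma mvar_inj m i j : (i < m)%N -> (j < m)%N -> mvar C m i = mvar C m j -> i = j.
Proof.
elim: m i j => //= m IH [|i] [|j] //= im jm.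
- by move/(congr1 (fun p : {poly _} => p`_1)); rewrite coefX coefC => /eqP; rewrite oner_eq0.
- by move/(congr1 (fun p : {poly _} => p`_1)); rewrite coefX coefC => /esym/eqP; rewrite oner_eq0.
by move/polyC_inj/IH => ->.
Qed.

Lemma zv_neq0 a : (a < n)%N -> zv C n a != 0.
Proof. by move=> an; rewrite tofrac_eq0 mvar_neq0. Qed.

Lemma zv_inj a b : (a < n)%N -> (b < n)%N -> zv C n a = zv C n b -> a = b.
Proof.
move=> an bn /eqP; rewrite tofrac_eq => /eqP E.
by case: (@mvar_inj n.+1 a.+1 b.+1 an bn E).
Qed.

(** h is the outermost polynomial variable, so h and 1 differ in the coefficient of degree 1. *)
Lemma hv_neq1 : 1 - hv C n != 0.
Proof.
rewrite subr_eq0 /hv -(tofrac1 (mpoly C n.+1)) tofrac_eq eq_sym.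
apply/eqP => /(congr1 (fun p : {poly _} => p`_1)) /=.
by rewrite coefX coefC => /eqP; rewrite oner_eq0.
Qed.

(** Otherwise z_a = h z_b, and comparing constant coefficients in the outermost variable h gives z_a
    = 0. The indices may coincide. *)
Lemma one_sub_hz_neq0 a b : (a < n)%N -> 1 - hv C n * zv C n b / zv C n a != 0.
Proof.
move=> an; rewrite subr_eq0; apply/eqP => E.
have /eqP : zv C n a = hv C n * zv C n b.
  by rewrite -[RHS](divfK (zv_neq0 an)) -E mul1r.
rewrite /hv /zv -tofracM tofrac_eq.
apply/negP; apply/eqP => /(congr1 (fun p : {poly _} => p`_0)) /=.
rewrite coefXM coefC /= => /eqP; apply/negP; exact: mvar_neq0.
Qed.

Lemma one_sub_z_neq0 a b : (a < n)%N -> (b < n)%N ->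
  (1 - zv C n b / zv C n a != 0) = (a != b).
Proof.
move=> an bn; rewrite subr_eq0 eq_sym; congr (~~ _); apply/eqP/eqP => [E|->].
  by apply: zv_inj => //; rewrite -[RHS](divfK (zv_neq0 an)) E mul1r.
by rewrite divff ?zv_neq0.
Qed.

Lemma zvec_inj : injective (zvec C n).
Proof. by move=> i j ij; apply: val_inj; apply: zv_inj ij. Qed.

Lemma zvec_torus : torus (zvec C n).
Proof. by move=> i; apply: zv_neq0. Qed.

Lemma lcoef_mapc (f : lpoly C n) e : lcoef (lmapc C n f) e = cF C n (lcoef f e).
Proof.
rewrite /lcoef big_map; elim: f => [|t f IH]; first by rewrite !big_nil cF0.
by rewrite !big_cons; case: ifP => //=; rewrite cFD IH.
Qed.

Lemma Ssym_leval (f : lpoly C n) (x : 'I_n -> F) (s : {perm 'I_n}) : Ssym C n f ->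
  leval (lmapc C n f) (fun i => x (s i)) = leval (lmapc C n f) x.
Proof.
move=> fs; rewrite -[s]invgK -leval_perm; apply: lequiv_leval => e.
have -> : lperm s^-1 (lmapc C n f) = lmapc C n (lperm s^-1 f) by rewrite /lperm /lmapc -!map_comp.
by rewrite !lcoef_mapc fs.
Qed.

Lemma lmapc_esymL k : lmapc C n (esymL C n k) = esymL F n k.
Proof. by rewrite /lmapc /esymL -map_comp; apply: eq_map => A /=; rewrite cF1. Qed.

Lemma Ssym_esymL k : Ssym C n (esymL C n k).
Proof.
move=> s; apply: leval_lequiv; first exact: pchar_num.
by move=> x _; rewrite leval_perm !leval_esymL esymv_perm.
Qed.

End FunctionField.

(** * Restriction to the fixed points *)

Section Blocks.
Variables (C : numClosedFieldType) (N n : nat) (lam : 'I_N -> nat).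
Hypothesis Hlam : (\sum_(k < N) lam k)%N = n.
Local Notation F := (Fz C n).
Local Notation lamp := (lamp N lam).
Local Notation blk := (blk N lam).
Local Notation Ilam := (Ilam N n lam).
Local Notation OP := (OP N n).
Local Notation Rinv := (Rinv C N n lam).
Local Notation inJ := (inJ C N n lam).
Local Notation restr := (restr C N n lam).
Local Notation zvec := (zvec C n).
Implicit Types (I J : OP) (r : lpoly F n) (w s : {perm 'I_n}) (p : 'I_n).

Lemma lamp0 : lamp 0 = 0%N.
Proof. by rewrite /Defs.lamp big_pred0. Qed.

Lemma lampN : lamp N = n.
Proof. by rewrite /Defs.lamp -[RHS]Hlam; apply: eq_bigl => i; rewrite ltn_ord. Qed.

Lemma lampS (k : 'I_N) : lamp k.+1 = (lamp k + lam k)%N.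
Proof.
rewrite /Defs.lamp (bigD1 k) //= addnC; congr (_ + _)%N.
by apply: eq_bigl => i; rewrite -(inj_eq val_inj) /=; lia.
Qed.

Lemma leq_lamp j k : (j <= k)%N -> (lamp j <= lamp k)%N.
Proof.
move=> jk; rewrite /Defs.lamp [X in (_ <= X)%N](bigID (fun i : 'I_N => (i < j)%N)) /=.
rewrite [X in (_ <= X + _)%N](eq_bigl (fun i : 'I_N => (i < j)%N)) ?leq_addr // => i.
by lia.
Qed.

(** The indices satisfying [P] form an initial segment. Applied to [blk], which is such a count,
    this turns bounds on [blk p] into bounds on [p]. *)
Lemma count_prefix (P : nat -> bool) m k : (forall i, P i.+1 -> P i) -> (k < m)%N ->
  (k < \sum_(i < m) P i)%N = P k.
Proof.
move=> Pd; have PT i j : (i <= j)%N -> P j -> P i.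
  by move/subnK <-; elim: (j - i)%N => // d IH; rewrite addSn => /Pd.
have lem d : (\sum_(i < d) P i <= d)%N.
  rewrite -[X in (_ <= X)%N]card_ord -sum1_card; apply: leq_sum => i _.
  by case: (P i).
elim: m k => // m IH k; rewrite ltnS big_ord_recr /=.
case: (boolP (P m)) => Pm.
  have -> : (\sum_(i < m) P i)%N = m.
    by rewrite -[RHS]card_ord -sum1_card; apply: eq_bigr => i _; rewrite (PT _ _ _ Pm) 1?ltnW.
  by move=> km; rewrite (PT k m) //; lia.
rewrite addn0 leq_eqVlt => /orP[/eqP ->|/IH //].
by rewrite (negbTE Pm) ltnNge lem.
Qed.

Lemma blkP p : (blk p < N)%N /\ (lamp (blk p) <= p < lamp (blk p).+1)%N.
Proof.
have blkE k : (k < N)%N -> (k < blk p)%N = (lamp k.+1 <= p)%N.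
  apply: (count_prefix (P := fun k => (lamp k.+1 <= p)%N)) => i.
  by apply: leq_trans; apply: leq_lamp.
have N0 : (0 < N)%N.
  by case: posnP => // N0; have := ltn_ord p; rewrite -[X in (_ < X)%N]lampN [X in lamp X]N0 lamp0.
have bN : (blk p < N)%N.
  have := blkE N.-1; rewrite prednK // lampN => /(_ (leqnn _)).
  by have := ltn_ord p; lia.
split=> //; apply/andP; split; last by have := blkE _ bN; lia.
case E : (blk p) => [|b]; first by rewrite lamp0.
by have := blkE b; rewrite E; lia.
Qed.

Lemma blk_eq p (k : 'I_N) : (blk p == k) = (lamp k <= p < lamp k.+1)%N.
Proof.
have [_ /andP[b1 b2]] := blkP p; apply/eqP/idP => [<-|/andP[k1 k2]]; first by rewrite b1.
case: (ltngtP (blk p) k) => // /leq_lamp; lia.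
Qed.

Lemma card_blk (k : 'I_N) : #|[set p : 'I_n | blk p == k]| = lam k.
Proof.
have Hs a b m : (a <= b)%N -> (\sum_(i < m) (a <= i < b) = minn m b - a)%N.
  by move=> ab; elim: m => [|m IH]; rewrite ?big_ord0 ?big_ord_recr /= ?IH; lia.
rewrite -sum1dep_card big_mkcond /=.
rewrite (eq_bigr (fun p : 'I_n => nat_of_bool (lamp k <= p < lamp k.+1)%N)) => [|p _].
  by rewrite Hs; rewrite ?lampS; [have := leq_lamp (ltn_ord k); rewrite lampN lampS; lia | lia].
by rewrite blk_eq; case: ifP.
Qed.

Definition blko p : 'I_N := Ordinal (blkP p).1.

(** The image under [w] of the standard partition into consecutive blocks: the fixed point that z_w
    represents up to permutations inside blocks. *)
Definition block_of w : OP := [ffun q => blko ((w^-1)%g q)].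

Lemma block_of_Ilam w : block_of w \in Ilam.
Proof.
rewrite inE; apply/forallP => k; rewrite -[X in _ == X]card_blk.
apply/eqP; rewrite -[RHS](card_preimset _ (@perm_inj _ (w^-1)%g)); apply: eq_card => q.
by rewrite !inE ffunE -(inj_eq val_inj).
Qed.

Lemma Ilam_card J (k : 'I_N) : J \in Ilam -> #|[set a | J a == k]| = lam k.
Proof. by rewrite inE => /forallP/(_ k)/eqP. Qed.

(** A right inverse of [block_of] on [Ilam]: it maps each standard block increasingly onto the block
    of [J]. The default [p] of [nth] is never reached when [J] is in [Ilam]. *)
Definition wfun J p : 'I_n :=
  nth p [seq i <- enum 'I_n | nat_of_ord (J i) == blk p] (p - lamp (blk p)).

Lemma wfun_size J p : J \in Ilam ->
  (p - lamp (blk p) < size [seq i <- enum 'I_n | nat_of_ord (J i) == blk p])%N.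
Proof.
move=> JI; have -> : size [seq i <- enum 'I_n | nat_of_ord (J i) == blk p] = lam (blko p).
  rewrite -(Ilam_card _ JI) -(card_uniqP (filter_uniq _ (enum_uniq _))).
  by apply: eq_card => i; rewrite mem_filter mem_enum !inE andbT.
by have [_] := blkP p; have := lampS (blko p); rewrite /=; lia.
Qed.

Lemma wfun_blk J p : J \in Ilam -> J (wfun J p) = blk p :> nat.
Proof.
move=> JI; have /(mem_nth p) := wfun_size p JI.
by rewrite mem_filter => /andP[/eqP].
Qed.

Lemma wfun_inj J : J \in Ilam -> injective (wfun J).
Proof.
move=> JI p q pq; have bpq : blk p = blk q by rewrite -!(wfun_blk _ JI) pq.
have sp := wfun_size p JI; have sq := wfun_size q JI.
have us : uniq [seq i <- enum 'I_n | nat_of_ord (J i) == blk q] by rewrite filter_uniq ?enum_uniq.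
apply: val_inj => /=.
have := congr1 (index^~ [seq i <- enum 'I_n | nat_of_ord (J i) == blk q]) pq.
rewrite /= /wfun bpq in sp *; rewrite !index_uniq //.
have [_] := blkP p; have [_] := blkP q; rewrite bpq; lia.
Qed.

Lemma xJ_wfun J p : J \in Ilam -> xJ C N n lam J p = zvec (wfun J p).
Proof.
by move=> JI; rewrite /xJ /posb /zvec (nth_map p) ?wfun_size.
Qed.

Lemma Rinv_leval r : Rinv r <-> (forall s, (forall p, blk (s p) = blk p) ->
  forall x, torus x -> leval r (fun i => x (s i)) = leval r x).
Proof.
split=> H s hs.
  have hs' p : blk ((s^-1)%g p) = blk p by rewrite -[in RHS](permKV s p) hs.
  by move=> x _; rewrite -(lequiv_leval x (H _ hs')) leval_perm invgK.
apply: leval_lequiv; first exact: pchar_Fz.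
have hs' p : blk ((s^-1)%g p) = blk p by rewrite -[in RHS](permKV s p) hs.
by move=> x x0; rewrite leval_perm (H _ hs').
Qed.

Lemma restr_perm r J : J \in Ilam -> restr r J = leval r (fun p => zvec (wfun J p)).
Proof. by move=> JI; apply: eq_leval => p; rewrite xJ_wfun. Qed.

(** A fixed point is z_w for some permutation w, and there f(gamma) = f(z) for every symmetric f. *)
Lemma inJ_restr0 r J : inJ r -> J \in Ilam -> restr r J = 0.
Proof.
move=> [gs [gsP rE]] JI; rewrite restr_perm //.
pose w := perm (wfun_inj JI).
rewrite (@eq_leval _ _ _ _ (fun p => zvec (w p))) => [|p]; last by rewrite permE.
rewrite (lequiv_leval _ rE) leval_flatten big_seq big1 // => g /gsP[_ gS].
rewrite leval_mul => [|p]; last exact: zvec_torus.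
by rewrite leval_sub leval_const Ssym_leval // subrr mulr0.
Qed.

Lemma block_of_wfun w p : blk ((w^-1)%g (wfun (block_of w) p)) = blk p.
Proof. by rewrite -[RHS](wfun_blk p (block_of_Ilam w)) ffunE. Qed.

(** The points z_w and x_J with J = [block_of w] differ by a block-preserving permutation, which an
    invariant [r] does not see. *)
Lemma restr0_leval r w : Rinv r -> (forall J, J \in Ilam -> restr r J = 0) ->
  leval r (fun i => zvec (w i)) = 0.
Proof.
move=> /Rinv_leval rI r0; have JI := block_of_Ilam w.
rewrite -(r0 _ JI) restr_perm //.
pose v := perm (wfun_inj JI).
have vP p : blk ((v * w^-1)%g p) = blk p by rewrite permM [v p]permE block_of_wfun.
rewrite -(rI _ vP); last by move=> i; apply: zvec_torus.
by apply: eq_leval => p; rewrite permM permKV [v p]permE.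
Qed.

Lemma restr0_inJ r : Rinv r -> (forall J, J \in Ilam -> restr r J = 0) -> inJ r.
Proof.
move=> rI r0.
have [g gE] := vanishing_symideal (@zvec_inj C n) (@zvec_torus C n)
   (fun w => restr0_leval w rI r0).
pose G := [set s : {perm 'I_n} | [forall p : 'I_n, blk (s p) == blk p]].
have GP s : reflect (forall p, blk (s p) = blk p) (s \in G).
  by rewrite inE; apply: (iffP forallP) => H p; apply/eqP.
have G0 : (#|G|%:R : F) != 0.
  rewrite ((pcharf0P F).1 (pchar_Fz C n)) -lt0n; apply/card_gt0P; exists 1%g.
  by apply/GP => p; rewrite perm1.
(* The average of the coefficient [g k] over the group [G] of block-preserving permutations. As [r]
   and the e_k are invariant under [G], averaging the relation [gE] changes only its
   coefficients. *)
pose g' k := flatten [seq lscale (#|G|%:R)^-1 (lperm s (g k)) | s <- enum G].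
have g'E k x : leval (g' k) x =
    (#|G|%:R)^-1 * \sum_(s in G) leval (g k) (fun i => x ((s^-1)%g i)).
  rewrite leval_flatten big_enum /= mulr_sumr; apply: eq_bigr => s _.
  by rewrite leval_scale leval_perm.
exists [seq (g' k, esymL C n k) | k <- iota 0 n.+1]; split.
  move=> _ /mapP[k _ ->]; split; last exact: Ssym_esymL.
  apply/Rinv_leval => s sP x x0; rewrite !g'E; congr (_ * _).
  rewrite [RHS](reindex_inj (mulgI (s^-1)%g)) /=; apply: eq_big => t.
    apply/GP/GP => tP p; first by rewrite permM tP -[in RHS](permKV s p) sP.
    by rewrite -[in RHS]sP -[in RHS]tP permM permK.
  by move=> _; apply: eq_leval => i; rewrite invMg invgK permM.
apply: leval_lequiv; first exact: pchar_Fz.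
move=> x x0; rewrite leval_flatten big_map -[iota 0 n.+1]/(index_iota 0 n.+1) big_mkord.
have -> : leval r x = (#|G|%:R)^-1 * \sum_(s in G) leval r (fun i => x ((s^-1)%g i)).
  rewrite (eq_bigr (fun=> leval r x)) ?sumr_const => [|s /GP sP].
    by rewrite -[X in _ * X]mulr_natl mulKf.
  rewrite ((Rinv_leval r).1 rI) // => p; by rewrite -[in RHS](permKV s p) sP.
rewrite (eq_bigr (fun s : {perm 'I_n} => \sum_(k < n.+1) leval (g k) (fun i => x ((s^-1)%g i)) *
   (esymv k x - esymv k zvec))) => [|s _]; last first.
  by rewrite gE => [|i]; [apply: eq_bigr => k _; rewrite esymv_perm | exact: x0].
rewrite exchange_big /= mulr_sumr; apply: eq_bigr => k _.
rewrite leval_mul // leval_sub leval_const lmapc_esymL !leval_esymL g'E -mulr_suml.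
by rewrite mulrA.
Qed.

Lemma exists_class (f : OP -> F) : exists r, isClass C N n lam f r.
Proof.
have [r rE] : regular (fun x => \sum_(w : {perm 'I_n}) f (block_of w) * eu zvec [ffun i => w i] x).
  apply: regular_sum => w; apply: regularM; first exact: regular_const.
  exact: regular_eu.
exists r; split.
  apply/Rinv_leval => s sP x x0; have xs0 : torus (fun i => x (s i)) by move=> i; apply: x0.
  rewrite (rE _ x0) (rE _ xs0).
  (* Replacing w by [s * w] keeps [block_of w], as [s] preserves blocks, and absorbs the permutation
     of the variables in [eu]. *)
  rewrite [LHS](reindex_inj (mulgI s)) /=; apply: eq_bigr => w _; congr (_ * _).
    congr f; apply/ffunP => q; rewrite !ffunE; apply: val_inj; rewrite /= invMg permM.
    by rewrite -[in RHS](permKV s ((w^-1)%g q)) sP.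
  rewrite /eu [RHS](reindex_inj (@perm_inj _ s)) /=; apply: eq_bigr => i _.
  by rewrite !ffunE permM.
move=> J JI; rewrite restr_perm //; pose v := perm (wfun_inj JI).
rewrite (@eq_leval _ _ _ _ (fun p => zvec (v p))) => [|p]; last by rewrite permE.
rewrite rE => [|p]; last exact: zvec_torus.
have <- : block_of v = J.
  apply/ffunP => q; rewrite ffunE; apply: val_inj; rewrite /= -(wfun_blk _ JI).
  by rewrite -[in RHS](permKV v q) [v _]permE.
rewrite (bigD1 v) //= eu_perm ?eqxx ?mulr1; last exact: zvec_inj.
rewrite big1 ?addr0 // => w wv; rewrite eu_perm ?(negbTE wv) ?mulr0 //; exact: zvec_inj.
Qed.

Lemma leval_lcomb (c : OP -> F) (b : OP -> lpoly F n) x :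
  leval (lcomb C N n lam c b) x = \sum_(I in Ilam) c I * leval (b I) x.
Proof.
by rewrite leval_flatten big_enum /=; apply: eq_bigr => I _; rewrite leval_scale.
Qed.

Lemma Rinv_lsub r r' : Rinv r -> Rinv r' -> Rinv (lsub r r').
Proof.
move=> /Rinv_leval H /Rinv_leval H'; apply/Rinv_leval => s sP x x0.
by rewrite !leval_sub H ?H'.
Qed.

Lemma Rinv_lcomb c b : (forall I, I \in Ilam -> Rinv (b I)) -> Rinv (lcomb C N n lam c b).
Proof.
move=> bR; apply/Rinv_leval => s sP x x0; rewrite !leval_lcomb; apply: eq_bigr => I II.
by rewrite ((Rinv_leval _).1 (bR _ II)).
Qed.

(** * From nondegenerate matrices of restrictions to bases *)

Definition nondegenerate_family (f : OP -> OP -> F) := forall c : OP -> F,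
  (forall J, J \in Ilam -> \sum_(I in Ilam) c I * f I J = 0) ->
  forall I, I \in Ilam -> c I = 0.

(** The matrix of [f] is square, so independence of its rows makes it invertible. *)
Lemma nondegenerate_surj f (v : OP -> F) : nondegenerate_family f ->
  exists c : OP -> F, forall J, J \in Ilam -> \sum_(I in Ilam) c I * f I J = v J.
Proof.
(* [enum_rank_in] needs an element of [Ilam], hence the separate empty case. *)
move=> fnd; case: (set_0Vmem Ilam) => [I0|[I0 I0I]].
  by exists v => J; rewrite I0 inE.
pose rk := enum_rank_in I0I.
have rkK i : rk (enum_val i) = i by rewrite /rk enum_valK_in.
have valK I : I \in Ilam -> enum_val (rk I) = I by move=> II; rewrite /rk enum_rankK_in.
pose M : 'M[F]_#|Ilam| := \matrix_(i, j) f (enum_val i) (enum_val j).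
have sumE (u : 'rV[F]_#|Ilam|) J : J \in Ilam ->
    \sum_(I in Ilam) u 0 (rk I) * f I J = (u *m M) 0 (rk J).
  move=> JI; rewrite mxE (reindex_onto (@enum_val _ (mem Ilam)) rk) /=; last first.
    by move=> I II; rewrite valK.
  apply: eq_big => [i|i _]; first by rewrite enum_valP rkK eqxx.
  by rewrite mxE rkK valK.
have Mu : M \in unitmx.
  rewrite -row_free_unit; apply: inj_row_free => u uM; apply/rowP => i.
  have := fnd (fun I => u 0 (rk I)) _ (enum_val i) (enum_valP i).
  rewrite /= rkK mxE; apply => J JI.
  by rewrite sumE // uM mxE.
exists (fun I => ((\row_j v (enum_val j)) *m invmx M) 0 (rk I)) => J JI.
by rewrite sumE // mulmxKV // mxE valK.
Qed.

(** An invariant polynomial is determined modulo [inJ] by its restrictions, so uniqueness, spanning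
    and independence are all checked at the fixed points. *)
Lemma nondegenerate_basis f : nondegenerate_family f -> classes_form_basis C N n lam f.
Proof.
move=> fnd; split=> [I _|I _ r r' [rI rE] [r'I r'E]|b bP]; first exact: exists_class.
  apply: restr0_inJ => [|J JI]; first exact: Rinv_lsub.
  by rewrite /Defs.restr leval_sub -!/(restr _ _) rE ?r'E ?subrr.
have lcE c J : J \in Ilam -> restr (lcomb C N n lam c b) J = \sum_(I in Ilam) c I * f I J.
  move=> JI; rewrite /Defs.restr leval_lcomb; apply: eq_bigr => I II.
  by rewrite -/(restr _ _) (bP I II).2.
split=> [r rI|c cJ].
  have [c cE] := nondegenerate_surj (restr r) fnd; exists c.
  apply: restr0_inJ => [|J JI].
    by apply: Rinv_lsub => //; apply: Rinv_lcomb => I /bP[].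
  by rewrite /Defs.restr leval_sub -!/(restr _ _) lcE // cE // subrr.
by apply: fnd => J JI; rewrite -lcE // inJ_restr0.
Qed.

End Blocks.

(** * Triangularity of the weight functions *)

Section Enumerations.
Variable n : nat.
Implicit Types (f : nat -> nat) (P : pred 'I_n).

(** The order of the listing is left free, so the property survives the permutations of the
    symmetrization. *)
Definition enumerates f m P := perm_eq (mkseq f m) [seq nat_of_ord i | i <- enum 'I_n & P i].

Lemma enumerates_mem f m P a : enumerates f m P -> (a < m)%N ->
  exists2 i : 'I_n, P i & f a = i.
Proof.
move=> /perm_mem fP am; have : f a \in mkseq f m by rewrite map_f // mem_iota.
by rewrite fP => /mapP[i]; rewrite mem_filter => /andP[Pi _]; exists i.
Qed.

Lemma enumerates_surj f m P (i : 'I_n) : enumerates f m P -> P i ->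
  exists2 a, (a < m)%N & f a = i.
Proof.
move=> /perm_mem fP Pi; have : nat_of_ord i \in mkseq f m.
  by rewrite fP map_f // mem_filter Pi mem_enum.
by case/mapP => a; rewrite mem_iota => am ->; exists a.
Qed.

Lemma enumerates_inj f m P a b : enumerates f m P -> (a < m)%N -> (b < m)%N ->
  f a = f b -> a = b.
Proof.
move=> /perm_uniq fP am bm; rewrite -(nth_mkseq 0%N f am) -(nth_mkseq 0%N f bm) => /eqP.
rewrite nth_uniq ?size_mkseq // => [/eqP //|].
by rewrite fP map_inj_uniq ?(filter_uniq _ (enum_uniq _)) //; apply: ord_inj.
Qed.

Lemma enumerates_sum f m P (G : nat -> nat) : enumerates f m P ->
  (\sum_(a < m) G (f a) = \sum_(i | P i) G i)%N.
Proof.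
move=> fP; transitivity (\sum_(j <- mkseq f m) G j)%N.
  by rewrite big_map -[m in iota 0 m]subn0 -/(index_iota 0 m) big_mkord.
by rewrite (perm_big _ fP) big_map big_filter big_enum_cond; apply: eq_bigl => i.
Qed.

Lemma pact_ord (s : {perm 'I_n}) (i : 'I_n) : pact n s i = s i.
Proof. by rewrite /pact valK. Qed.

End Enumerations.

Section Triangularity.
Variables (C : numClosedFieldType) (N n : nat) (lam : 'I_N -> nat).
Hypothesis Hlam : (\sum_(k < N) lam k)%N = n.
Local Notation F := (Fz C n).
Local Notation lamp := (lamp N lam).
Local Notation Ilam := (Ilam N n lam).
Local Notation OP := (OP N n).
Local Notation pos := (pos N n).
Local Notation permfam := (permfam N n).
Local Notation permfam_ok := (permfam_ok N n lam).
Local Notation spick := (spick N n).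
Local Notation Ufun := (Ufun C N n lam).
Local Notation h := (hv C n).
Implicit Types (I J : OP) (s : permfam).

Lemma card_Ilam_le J k : J \in Ilam -> #|[set i | (J i < k)%N]| = lamp k.
Proof.
move=> JI; rewrite -sum1dep_card (partition_big J (fun j : 'I_N => (j < k)%N)) //=.
apply: eq_bigr => j jk; rewrite -(Ilam_card j JI) -sum1dep_card.
by apply: eq_bigl => i; case: eqP => [->|]; rewrite ?jk ?andbF.
Qed.

Lemma lamp_le_n k : (lamp k <= n)%N.
Proof.
rewrite -[X in (_ <= X)%N]Hlam /Defs.lamp.
by rewrite [X in (_ <= X)%N](bigID (fun i : 'I_N => (i < k)%N)) leq_addr.
Qed.

Lemma pos_enumerates J k : J \in Ilam ->
  enumerates (pos J k) (lamp k.+1) (fun i => J i < k.+1)%N.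
Proof.
move=> JI; rewrite /enumerates.
have <- : size [seq nat_of_ord i | i <- enum 'I_n & (J i < k.+1)%N] = lamp k.+1.
  rewrite size_map -(card_uniqP (filter_uniq _ (enum_uniq _))) -(card_Ilam_le _ JI).
  by apply: eq_card => i; rewrite mem_filter mem_enum !inE andbT.
by rewrite mkseq_nth.
Qed.

Lemma pos_top J c : (c < n)%N -> pos J N.-1 c = c.
Proof.
move=> cn; rewrite /Defs.pos (eq_filter (a2 := xpredT)) => [|i].
  by rewrite filter_predT val_enum_ord nth_iota.
by have := ltn_ord (J i); lia.
Qed.

Lemma spick_lt s k (kN : (k < N.-1)%N) (i : 'I_n) : spick s k i = s (Ordinal kN) i.
Proof. by rewrite /Defs.spick insubT pact_ord. Qed.

Lemma spick_ge s k a : (N.-1 <= k)%N -> spick s k a = a.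
Proof. by move=> kN; rewrite /Defs.spick insubN // -leqNgt. Qed.

Lemma spick_perm s k : permfam_ok s -> (k < N.-1)%N ->
  perm_eq (mkseq (spick s k) (lamp k.+1)) (iota 0 (lamp k.+1)).
Proof.
move=> sok kN; have ordE a : (a < lamp k.+1)%N -> exists i : 'I_n, a = i.
  by move=> /leq_trans/(_ (lamp_le_n _)) an; exists (Ordinal an).
have sfix (i : 'I_n) : (lamp k.+1 <= i)%N -> s (Ordinal kN) i = i.
  by have /forallP/(_ (Ordinal kN))/forallP/(_ i)/implyP H := sok; move/H/eqP.
have us : uniq (mkseq (spick s k) (lamp k.+1)).
  rewrite map_inj_in_uniq ?iota_uniq // => a b; rewrite !mem_iota add0n /=.
  move=> /ordE[i ->] /ordE[j ->]; rewrite !spick_lt => /ord_inj /perm_inj -> //.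
have sub : {subset mkseq (spick s k) (lamp k.+1) <= iota 0 (lamp k.+1)}.
  move=> _ /mapP[a + ->]; rewrite !mem_iota add0n /= => am.
  have [i ai] := ordE _ am; rewrite ai spick_lt ltnNge; apply/negP => sm.
  have /perm_inj si := sfix _ sm; rewrite si -ai in sm; lia.
apply: uniq_perm => //; first exact: iota_uniq.
by have [] := uniq_min_size us sub; rewrite ?size_mkseq ?size_iota.
Qed.

Variable sigma : {perm 'I_n}.

(** The index of the z-variable substituted for t^(k+1)_(a+1) in the term of [s] at z_J; the last
    group is z itself, reordered by [sigma]. *)
Definition ix s J k a : nat :=
  if (k < N.-1)%N then pos J k (spick s k a) else pact n sigma (spick s k a).

Lemma ix_enumerates s J k : permfam_ok s -> J \in Ilam -> (k < N)%N ->
  enumerates (ix s J k) (lamp k.+1) (fun i => J i < k.+1)%N.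
Proof.
move=> sok JI kN; case: (ltnP k N.-1) => kN1.
  apply: perm_trans (pos_enumerates k JI).
  have -> : mkseq (ix s J k) (lamp k.+1) = map (pos J k) (mkseq (spick s k) (lamp k.+1)).
    by rewrite -map_comp; apply: eq_map => a; rewrite /ix kN1.
  exact/perm_map/spick_perm.
have kE : k.+1 = N by lia.
rewrite kE (lampN Hlam) /enumerates (eq_filter (a2 := xpredT)) => [|i]; last by rewrite ltn_ord.
rewrite filter_predT; apply: uniq_perm.
- rewrite map_inj_in_uniq ?iota_uniq // => a b; rewrite !mem_iota add0n /= => an bn.
  rewrite /ix ltnNge kN1 /= !spick_ge // -[a]/(val (Ordinal an)) -[b]/(val (Ordinal bn)) /=.
  by rewrite (pact_ord _ (Ordinal an)) (pact_ord _ (Ordinal bn)) => /ord_inj/perm_inj/(congr1 val).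
- by rewrite map_inj_uniq ?enum_uniq //; apply: ord_inj.
move=> b; apply/mapP/mapP => [[a + ->]|[i _ ->]].
  rewrite mem_iota add0n /= => an; exists (sigma (Ordinal an)); rewrite ?mem_enum //.
  by rewrite /ix ltnNge kN1 /= spick_ge // (pact_ord _ (Ordinal an)).
exists (nat_of_ord ((sigma^-1)%g i)); first by rewrite mem_iota add0n /=.
by rewrite /ix ltnNge kN1 /= spick_ge // pact_ord permKV.
Qed.

Definition avoids I (f : nat -> nat -> nat) := forall k a c, (k < N.-1)%N ->
  (a < lamp k.+1)%N -> (c < lamp k.+2)%N -> (pos I k a < pos I k.+1 c)%N -> f k a != f k.+1 c.

(** Only the factors 1 - t^(k+1)_c / t^(k)_a can vanish, and they do so at equal indices. Factors
    with h never vanish, and the denominators are nonzero because each level lists distinct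
    indices. *)
Lemma Ufun_neq0 I T (f : nat -> nat -> nat) (P : nat -> pred 'I_n) :
    (forall k a, T k a = zv C n (f k a)) ->
    (forall k, (k < N)%N -> enumerates (f k) (lamp k.+1) (P k)) ->
  Ufun I T h != 0 <-> avoids I f.
Proof.
move=> TE fP.
have fn k a : (k < N)%N -> (a < lamp k.+1)%N -> (f k a < n)%N.
  by move=> /fP kP /(enumerates_mem kP)[i _ ->].
split=> [/prodf_neq0 U0 k a c kN am cm ltac|Iav].
  have /prodf_neq0 := U0 (Ordinal kN) isT; move/(_ (Ordinal am) isT).
  rewrite /= !mulf_eq0 !negb_or => /andP[/andP[_ /prodf_neq0 H] _].
  have := H (Ordinal cm) ltac; rewrite /= !TE one_sub_z_neq0 //; apply: fn => //; lia.
apply/prodf_neq0 => k _; apply/prodf_neq0 => a _; have kN := ltn_ord k.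
have fa : (f k a < n)%N by apply: fn => //; lia.
rewrite !mulf_neq0 //; apply/prodf_neq0 => b.
- by move=> _; rewrite !TE one_sub_hz_neq0.
- by move=> ltab; rewrite !TE one_sub_z_neq0 //; [apply: Iav | apply: fn => //; lia].
- move=> ltab; rewrite !TE mulf_neq0 ?one_sub_hz_neq0 // invr_eq0 one_sub_z_neq0 //.
    apply/eqP => /(enumerates_inj (fP _ _)) H.
    by move: ltab; rewrite H ?ltnn //; lia.
  by apply: fn => //; lia.
Qed.

(** * Nonzero terms of the symmetrization at a fixed point *)

Local Notation Isig I := ([ffun i => I (sigma i)] : OP).

Lemma Isig_Ilam I : I \in Ilam -> Isig I \in Ilam.
Proof.
move=> II; rewrite inE; apply/forallP => k; rewrite -[X in _ == X](Ilam_card k II); apply/eqP.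
rewrite -[RHS](card_preimset _ (@perm_inj _ sigma)).
by apply: eq_card => i; rewrite !inE ffunE.
Qed.

Local Notation pactV := (pact n (sigma^-1)%g).

Definition Wterm I J s : F := Ufun (Isig I)
  (fun k a => if (k < N.-1)%N then zv C n (pos J k (spick s k a))
              else zv C n (pact n sigma (spick s k a))) h.

Lemma Wterm_neq0 I J s : permfam_ok s -> J \in Ilam ->
  Wterm I J s != 0 <-> avoids (Isig I) (ix s J).
Proof.
move=> sok JI; apply: Ufun_neq0 => [k a|k kN]; last exact: ix_enumerates sok JI kN.
by rewrite /ix; case: ifP.
Qed.

Lemma pactV_ix s J k : permfam_ok s -> J \in Ilam -> (k < N)%N ->
  forall a, (a < lamp k.+1)%N ->
  exists2 i : 'I_n, (J i < k.+1)%N & ix s J k a = i /\ pactV (ix s J k a) = (sigma^-1)%g i.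
Proof.
move=> sok JI kN a am; have [i Ji ai] := enumerates_mem (ix_enumerates sok JI kN) am.
by exists i => //; rewrite ai pact_ord.
Qed.

(* Descending induction on k: the factors 1 - t^(k+1)_c / t^(k)_a kill the term
   unless t^(k)_a equals some t^(k+1)_c with i^(k+1)_c <= i^(k)_a. *)
Lemma ix_le_pos I J s : I \in Ilam -> J \in Ilam -> permfam_ok s ->
    Wterm I J s != 0 ->
  forall k a, (k < N)%N -> (a < lamp k.+1)%N -> (pactV (ix s J k a) <= pos (Isig I) k a)%N.
Proof.
move=> II JI sok /Wterm_neq0-/(_ sok JI) av k.
(* [d] is the distance to the top level; the second alternative makes [d] exist for every [k] and
   contradicts [k < N]. *)
have [d dE] : exists d, (d + k)%N = N.-1 \/ (N <= k)%N by exists (N.-1 - k)%N; lia.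
elim: d k dE => [|d IH] k dE a kN am.
  have kE : k = N.-1 by lia.
  have an : (a < n)%N by apply: leq_trans am (lamp_le_n _).
  rewrite kE pos_top // /ix ltnn spick_ge // (pact_ord _ (Ordinal an)) pact_ord permK.
  exact: leqnn.
have k1N : (k.+1 < N)%N by lia.
have [i Ji [iE _]] := pactV_ix sok JI kN am.
have Ji1 : (J i < k.+2)%N by lia.
have [c cm cE] := enumerates_surj (ix_enumerates sok JI k1N) Ji1.
have kN1 : (k < N.-1)%N by lia.
have := av k a c kN1 am cm; rewrite cE iE eqxx => pac.
rewrite -cE (leq_trans (IH k.+1 _ c k1N cm)) //; first by lia.
by rewrite leqNgt; apply/negP => /pac.
Qed.

Definition htk I k : nat := (\sum_(i | (I i < k.+1)%N) (sigma^-1)%g i)%N.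
Definition ht I : nat := (\sum_(k < N.-1) htk I k)%N.

Lemma sum_pos_htk I k : I \in Ilam -> (\sum_(a < lamp k.+1) pos (Isig I) k a = htk I k)%N.
Proof.
move=> II; rewrite (enumerates_sum id (pos_enumerates k (Isig_Ilam II))) /htk.
rewrite [RHS](reindex_inj (@perm_inj _ sigma)) /=.
by apply: eq_big => [i|i _]; rewrite ?ffunE ?permK.
Qed.

Lemma sum_ix_htk J s k : J \in Ilam -> permfam_ok s -> (k < N)%N ->
  (\sum_(a < lamp k.+1) pactV (ix s J k a) = htk J k)%N.
Proof.
move=> JI sok kN; rewrite (enumerates_sum pactV (ix_enumerates sok JI kN)) /htk.
by apply: eq_bigr => i _; rewrite pact_ord.
Qed.

Lemma eq_leq_sum (m : nat) (E1 E2 : 'I_m -> nat) : (forall i, E1 i <= E2 i)%N ->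
  (\sum_i E1 i = \sum_i E2 i)%N -> E1 =1 E2.
Proof.
move=> le12 /eqP; have [_ ->] := leqif_sum (fun i (_ : true) => leqif_eq (le12 i)).
by move=> /forallP H i; apply/eqP/H.
Qed.

(** Summing the bounds of [ix_le_pos] over all levels compares the heights; if the totals agree,
    every single bound is an equality. *)
Lemma Wterm_ht I J s : I \in Ilam -> J \in Ilam -> permfam_ok s -> Wterm I J s != 0 ->
  (ht J <= ht I)%N /\ (ht J = ht I -> forall k a, (k < N.-1)%N -> (a < lamp k.+1)%N ->
     pactV (ix s J k a) = pos (Isig I) k a).
Proof.
move=> II JI sok W0; have le := ix_le_pos II JI sok W0.
have lek (k : 'I_N.-1) : (htk J k <= htk I k)%N.
  have kN : (k < N)%N by have := ltn_ord k; lia.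
  by rewrite -(sum_ix_htk JI sok kN) -sum_pos_htk //; apply: leq_sum => a _; apply: le.
split=> [|eqh k a kN1 am]; first exact: leq_sum.
have kN : (k < N)%N by lia.
have := eq_leq_sum lek eqh (Ordinal kN1); rewrite /= -(sum_ix_htk JI sok kN) -sum_pos_htk //.
move/eq_leq_sum => H; exact: (H (fun a => le k a kN (ltn_ord a)) (Ordinal am)).
Qed.

Lemma WsigE I J : Wsig C N n lam sigma I J =
  (1 - h) ^+ lam1 N lam * \sum_(s | permfam_ok s) Wterm I J s.
Proof. by []. Qed.

Lemma Wsig_triangular I J : I \in Ilam -> J \in Ilam -> Wsig C N n lam sigma I J != 0 ->
  (ht J <= ht I)%N /\ (ht J = ht I -> J = I).
Proof.
move=> II JI; rewrite WsigE => W0.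
have [s /andP[sok]] : exists s, permfam_ok s && (Wterm I J s != 0).
  apply/existsP; apply: contraR W0 => /existsPn H; rewrite big1 ?mulr0 // => s sok.
  by have := H s; rewrite sok negbK => /eqP.
move=> /(Wterm_ht II JI sok)[leh eqh]; split=> // /eqh H.
(* Applying [sigma] to the equalities [H] shows that the first k+1 blocks of I and of J have the
   same union. *)
have JIle (i : 'I_n) k : (k < N.-1)%N -> (J i < k.+1)%N = (I i < k.+1)%N.
  move=> kN1; have kN : (k < N)%N by lia.
  apply/idP/idP => [Ji|Ii].
    have [a am aE] := enumerates_surj (ix_enumerates sok JI kN) Ji.
    have [j] := enumerates_mem (pos_enumerates k (Isig_Ilam II)) am.
    by rewrite -H // aE pact_ord ffunE => Ij /ord_inj E; rewrite -E permKV in Ij.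
  have Ii' : (Isig I ((sigma^-1)%g i) < k.+1)%N by rewrite ffunE permKV.
  have [a am] := enumerates_surj (pos_enumerates k (Isig_Ilam II)) Ii'.
  have [j Jj [_ jE]] := pactV_ix sok JI kN am.
  by rewrite -H // jE => /ord_inj/perm_inj <-.
(* If the block indices of [i] differed, the union up to the smaller one would contain [i] for only
   one of I and J. *)
apply/ffunP => i; apply: val_inj => /=; have := ltn_ord (I i); have := ltn_ord (J i).
case: (ltngtP (J i) (I i)) => // lt _ _.
  by have := JIle i (J i); have := ltn_ord (I i); lia.
by have := JIle i (I i); have := ltn_ord (J i); lia.
Qed.

(** At each level the union of the first blocks of I is listed in two ways, increasingly and by
    increasing [sigma^-1]; the permutation comparing the two lists is the required one. *)
Lemma exists_diagonal_perm I : I \in Ilam -> exists2 s, permfam_ok s &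
  forall k a, (k < N)%N -> (a < lamp k.+1)%N -> ix s I k a = pact n sigma (pos (Isig I) k a).
Proof.
move=> II; have JI := Isig_Ilam II.
(* Beyond [lamp k.+1] the relation forces the identity, as [permfam_ok] demands. *)
pose Q k (i j : 'I_n) := if (i < lamp k.+1)%N
    then (j < lamp k.+1)%N && (pos I k j == pact n sigma (pos (Isig I) k i)) else j == i.
have fE k (i : 'I_n) : exists j : 'I_n, Q k i j.
  rewrite /Q; case im: (i < lamp k.+1)%N; last by exists i.
  have [q] := enumerates_mem (pos_enumerates k JI) im; rewrite ffunE => Iq ->.
  have [a am aE] := enumerates_surj (pos_enumerates k II) Iq.
  by exists (Ordinal (leq_trans am (lamp_le_n _))); rewrite /= am aE pact_ord eqxx.
pose f k i := xchoose (fE k i).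
have fP k i : Q k i (f k i) by apply: xchooseP.
have finj k : injective (f k).
  move=> i j fij; have := fP k i; have := fP k j; rewrite /Q -fij.
  case: ifP => jm; case: ifP => im.
  - move=> /andP[_ /eqP ->] /andP[_ /eqP].
    have [q _ qE] := enumerates_mem (pos_enumerates k JI) im.
    have [q' _ qE'] := enumerates_mem (pos_enumerates k JI) jm.
    rewrite qE qE' !pact_ord => /ord_inj/perm_inj E; apply: ord_inj.
    by apply: (enumerates_inj (pos_enumerates k JI)); rewrite // qE qE' E.
  - by move=> /andP[fm _] /eqP fi; rewrite fi im in fm.
  - by move=> /eqP fj /andP[fm _]; rewrite fj jm in fm.
  by move=> /eqP <- /eqP ->.
exists [ffun k : 'I_N.-1 => perm (finj k)].
  apply/forallP => k; apply/forallP => i; apply/implyP => im.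
  by have := fP k i; rewrite /Q ltnNge im /= ffunE permE.
move=> k a kN am; have an := leq_trans am (lamp_le_n _).
rewrite /ix; case: ltnP => kN1.
  rewrite (spick_lt _ kN1 (Ordinal an)) ffunE permE.
  by have := fP k (Ordinal an); rewrite /Q /= am => /andP[_ /eqP].
have kE : k = N.-1 by lia.
by rewrite spick_ge // kE pos_top.
Qed.

(** For J = I the heights agree, so a nonzero term has all its z-indices prescribed. This singles
    out the family of [exists_diagonal_perm], whose term is nonzero because distinct positions give
    distinct indices. *)
Lemma Wsig_diag I : I \in Ilam -> Wsig C N n lam sigma I I != 0.
Proof.
move=> II; have JI := Isig_Ilam II; have [s sok sE] := exists_diagonal_perm II.
rewrite WsigE mulf_neq0 ?expf_neq0 ?hv_neq1 // (bigD1 s) //= big1 ?addr0.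
  apply/Wterm_neq0 => // k a c kN1 am cm ltac.
  have kN : (k < N)%N by lia.
  have k1N : (k.+1 < N)%N by lia.
  rewrite !sE //.
  have [i _ iE] := enumerates_mem (pos_enumerates k JI) am.
  have [j _ jE] := enumerates_mem (pos_enumerates k.+1 JI) cm.
  rewrite iE jE in ltac *; rewrite !pact_ord (inj_eq (@ord_inj n)) (inj_eq perm_inj).
  by apply: contraTneq ltac => ->; rewrite ltnn.
move=> t /andP[tok ts]; apply/eqP; apply: contraTT ts => W0.
rewrite negbK; have [_ /(_ erefl) tE] := Wterm_ht II II tok W0.
apply/eqP/ffunP => k; apply/permP => i; have kN1 := ltn_ord k.
have kN : (k < N)%N by lia.
case: (ltnP i (lamp k.+1)) => im; last first.
  have /forallP/(_ k)/forallP/(_ i)/implyP/(_ im)/eqP -> := tok.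
  by have /forallP/(_ k)/forallP/(_ i)/implyP/(_ im)/eqP -> := sok.
apply: ord_inj.
have kE : k = Ordinal kN1 by apply: ord_inj.
have ptE (u : permfam) : u k i = spick u k i :> nat by rewrite spick_lt -kE.
have spm (u : permfam) : permfam_ok u -> (spick u k i < lamp k.+1)%N.
  move=> uok; have /perm_mem/(_ (spick u k i)) := spick_perm uok kN1.
  by rewrite map_f ?mem_iota // add0n.
rewrite !ptE; apply: (enumerates_inj (pos_enumerates k II)); rewrite ?spm //.
have ixE (u : permfam) : pos I k (spick u k i) = ix u I k i by rewrite /ix kN1.
rewrite !ixE sE // -tE //.
have [j _ [-> ->]] := pactV_ix tok II kN im.
by rewrite pact_ord permKV.
Qed.

(** Take J of maximal height in the support of [c]. By triangularity any other K contributing to the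
    relation at J would be strictly higher, so only the diagonal entry remains. *)
Lemma Wsig_nondegenerate : nondegenerate_family lam (Wsig C N n lam sigma).
Proof.
move=> c c0 I II; apply/eqP; case: (boolP (c I == 0)) => // cI.
pose P := [pred I : OP | (I \in Ilam) && (c I != 0)].
have PI : P I by rewrite /= II.
case: (arg_maxnP ht PI) => J /= /andP[JI cJ] Jmax.
have := c0 J JI; rewrite (bigD1 J) //= big1 => [|K /andP[KI KJ]].
  by rewrite addr0 => /eqP; rewrite mulf_eq0 (negbTE cJ) (negbTE (Wsig_diag JI)).
apply/eqP; rewrite mulf_eq0; apply/negPn/negP; rewrite negb_or => /andP[cK W0].
have [leh eqh] := Wsig_triangular KI JI W0.
have KP : P K by rewrite /= KI.
have := Jmax K KP => leh'; move: KJ; rewrite eqh ?eqxx //.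
by apply/eqP; rewrite eqn_leq leh leh'.
Qed.

Lemma Esub_neq0 J : J \in Ilam -> Esub C N n lam J != 0.
Proof.
move=> JI; apply/prodf_neq0 => k _; apply/prodf_neq0 => a _; apply/prodf_neq0 => b _.
have [i _ ->] := enumerates_mem (pos_enumerates k JI) (ltn_ord a).
exact: one_sub_hz_neq0.
Qed.

(** The relation at J is the one for [Wsig] divided by [Esub J], a nonzero factor independent of
    I. *)
Lemma Wtsig_nondegenerate : nondegenerate_family lam (Wtsig C N n lam sigma).
Proof.
move=> c c0; apply: Wsig_nondegenerate => J JI; have /eqP := c0 J JI.
under eq_bigr do rewrite mulrA.
by rewrite -mulr_suml mulf_eq0 invr_eq0 (negbTE (Esub_neq0 JI)) orbF => /eqP.
Qed.

End Triangularity.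

Unset Implicit Arguments.

Theorem theorem6p8 (C : numClosedFieldType) (N n : nat) (lam : 'I_N -> nat)
  (Hlam : (\sum_(k < N) lam k)%N = n) (sigma : {perm 'I_n}) :
  classes_form_basis C N n lam (Wsig C N n lam sigma) /\
  classes_form_basis C N n lam (Wtsig C N n lam sigma).
Proof.
split; apply: nondegenerate_basis => //.
  exact: Wsig_nondegenerate.
exact: Wtsig_nondegenerate.
Qed.
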